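(* Let $n\ge2$. The functional $F_n:L_n\to\mathbb{R}$ attains its maximal value at a point $[\mu]\in L_n$ if and only if $\mu$ is isomorphic to the direct sum of the two-dimensional non-Lie symmetric Leibniz algebra with the trivial algebra. In such a case, $F_n([\mu])=20$.
   Context: Let $V_n=\otimes^2(\mathbb{C}^n)^*\otimes\mathbb{C}^n$ be the space of all bilinear maps $\mu:\mathbb{C}^n\times\mathbb{C}^n\to\mathbb{C}^n$. $\mathrm{GL}(n)$ acts on $V_n$ by $g.\mu(X,Y)=g\mu(g^{-1}X,g^{-1}Y)$. Fix a Hermitian inner product on $\mathbb{C}^n$; it induces the Hermitian inner product $\langle\mu,\lambda\rangle=\sum_{i,j,k}\langle\mu(X_i,X_j),X_k\rangle\overline{\langle\lambda(X_i,X_j),X_k\rangle}$ on $V_n$, where $\{X_i\}$ is any orthonormal basis of $\mathbb{C}^n$. On $\mathfrak{gl}(n)$ put $(A,B)=\operatorname{tr}AB^*$, where $^*$ is the conjugate transpose with respect to the fixed inner product; $\mathrm{i}\mathfrak{u}(n)$ is the space of Hermitian operators. The moment map $m:\mathbb{P}V_n\to\mathrm{i}\mathfrak{u}(n)$ is defined by $(m([\mu]),A)=(\mathrm{d}\rho_\mu)_eA/\|\mu\|^2$ for $A\in\mathrm{i}\mathfrak{u}(n)$, where $\rho_\mu(g)=\langle g.\mu,g.\mu\rangle$, and $F_n([\mu])=\|m([\mu])\|^2=(m([\mu]),m([\mu]))$. Explicitly $m([\mu])=\mathrm{M}_\mu/\|\mu\|^2$, where, with $L^\mu_X(Y)=\mu(X,Y)$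 and $R^\mu_X(Y)=\mu(Y,X)$, $\mathrm{M}_\mu=2\sum_iL^\mu_{X_i}(L^\mu_{X_i})^*-2\sum_i(L^\mu_{X_i})^*L^\mu_{X_i}-2\sum_i(R^\mu_{X_i})^*R^\mu_{X_i}$. A (left) Leibniz algebra is an algebra satisfying $x(yz)=(xy)z+y(xz)$ for all $x,y,z$; it is symmetric if moreover $(xy)z=(xz)y+x(yz)$ for all $x,y,z$. $L_n\subset\mathbb{P}V_n$ is the projectivization of the algebraic variety of all Leibniz algebra structures on $\mathbb{C}^n$. Up to isomorphism there is exactly one two-dimensional complex symmetric Leibniz algebra which is not a Lie algebra: it has a basis $\{e_1,e_2\}$ with $e_1e_1=e_2$ and all other products zero. The trivial algebra (here of dimension $n-2$) is the one with zero multiplication. *)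

(* Defs.v *)
From HB Require Import structures.
From mathcomp Require Import all_boot all_order all_algebra.
From mathcomp Require Import sesquilinear.
From mathcomp Require Import complex.
From mathcomp Require Import all_classical all_reals all_analysis.

Set Implicit Arguments.
Unset Strict Implicit.
Unset Printing Implicit Defensive.

Import Order.TTheory GRing.Theory Num.Theory Num.Def.
Import numFieldNormedType.Exports.
Local Open Scope ring_scope.
Local Open Scope complex_scope.
Local Open Scope classical_set_scope.
Local Open Scope sesquilinear_scope.

Section Algebras.
Variable R : realType.
Local Notation C := R[i].

(* Multiplications on C^n are plain functions; bilinearity is imposed separately,
   by the type {bilinear _ -> _ -> _}. *)
Definition product (n : nat) := 'cV[C]_n -> 'cV[C]_n -> 'cV[C]_n.

Definition left_leibniz n (mu : product n) : Prop :=
  forall x y z, mu x (mu y z) = mu (mu x y) z + mu y (mu x z).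

Definition right_leibniz n (mu : product n) : Prop :=
  forall x y z, mu (mu x y) z = mu (mu x z) y + mu x (mu y z).

Definition symmetric_leibniz n (mu : product n) : Prop :=
  left_leibniz mu /\ right_leibniz mu.

Definition lie n (mu : product n) : Prop :=
  (forall x, mu x x = 0) /\
  (forall x y z, mu x (mu y z) + mu y (mu z x) + mu z (mu x y) = 0).

Definition trivial_alg n : product n := fun _ _ => 0.

(* Representatives of the points of L_n, among the bilinear products: a point [mu] of
   the projective space is given by a nonzero mu, see FnZ. *)
Definition Ln_rep n (mu : product n) : Prop :=
  mu <> trivial_alg (n := n) /\ left_leibniz mu.

Definition direct_sum p q (mu : product p) (nu : product q) : product (p + q) :=
  fun x y => col_mx (mu (usubmx x) (usubmx y)) (nu (dsubmx x) (dsubmx y)).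

Definition isomorphic p q (mu : product p) (nu : product q) : Prop :=
  exists f : {linear 'cV[C]_p -> 'cV[C]_q},
    bijective f /\ forall x y, f (mu x y) = nu (f x) (f y).

(* e1 e1 = e2 and all other products of basis vectors vanish; the indices of
   e1 and e2 in 'I_2 are 0 and 1. *)
Definition nonlie2 : product 2 :=
  fun x y => (x 0 0 * y 0 0) *: delta_mx 1 0.

Lemma nonlie2_symmetric_leibniz : symmetric_leibniz nonlie2.
Proof.
by split=> x y z; rewrite /nonlie2 !mxE /= !(mulr0, mul0r) !scale0r addr0.
Qed.

Lemma nonlie2_not_lie : ~ lie nonlie2.
Proof.
move=> [/(_ (delta_mx 0 0)) + _] => /matrixP /(_ 1 0).
by rewrite /nonlie2 !mxE /= !mulr1 => /eqP; rewrite oner_eq0.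
Qed.

End Algebras.

Section MomentMap.
Variables (R : realType) (n : nat).
Local Notation C := R[i].
Variables (ip : {dot 'cV[C]_n for conjC}) (X : n.-tuple 'cV[C]_n).
Implicit Types (c : C) (mu lam : product R n) (g A B M : 'M[C]_n).

Definition act g mu : product R n :=
  fun x y => g *m mu (invmx g *m x) (invmx g *m y).

(* X is meant to be an orthonormal basis of ip. *)
Definition ipV mu lam : C :=
  \sum_(i < n) \sum_(j < n) \sum_(k < n)
    ip (mu (tnth X i) (tnth X j)) (tnth X k)
    * conjC (ip (lam (tnth X i) (tnth X j)) (tnth X k)).

Definition gram : 'M[C]_n :=
  \matrix_(i, j) ip (delta_mx j 0) (delta_mx i 0).

(* The adjoint for ip, see adjmxP; ip need not be the standard inner product. *)
Definition adjmx A : 'M[C]_n := invmx gram *m A ^t conjC *m gram.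

Definition selfadjoint A : Prop := adjmx A = A.

Definition ipM A B : C := \tr (A *m adjmx B).

Definition rho mu g : R := complex.Re (ipV (act g mu) (act g mu)).

Definition normV2 mu : R := complex.Re (ipV mu mu).

(* The differential of rho mu at the identity, in the direction A, computed along
   the curve 1 + t A, which lies in GL(n) for small real t. *)
Definition drho mu A : R := derive1 (fun t : R => rho mu (1%:M + t%:C *: A)) 0.

Definition is_moment mu M : Prop :=
  selfadjoint M /\
  forall A, selfadjoint A -> ipM M A = (drho mu A / normV2 mu)%:C.

Definition moment mu : 'M[C]_n := xget 0 [set M | is_moment mu M].

Definition Fn mu : R := complex.Re (ipM (moment mu) (moment mu)).

Lemma ip_gram u v : ip u v = ((v ^t conjC) *m gram *m u) 0 0.
Proof.
have E (w : 'cV[C]_n) : w = \sum_i w i 0 *: delta_mx i 0.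
  rewrite {1}[w]matrix_sum_delta; apply: eq_bigr => i _.
  by rewrite big_ord1.
rewrite {1}[u]E linear_sumlz mxE; apply: eq_bigr => j _.
rewrite linearZl_LR /= [X in ip _ X]E linear_sumr /= mxE mulrC; congr (_ * _).
apply: eq_bigr => i _.
by rewrite linearZr_LR /= !mxE.
Qed.

Lemma gram_herm : gram ^t conjC = gram.
Proof.
by apply/matrixP => i j; rewrite !mxE [RHS]hermC /= expr0 mul1r.
Qed.

Lemma gram_unit : gram \in unitmx.
Proof.
rewrite -unitmx_tr -row_free_unit -kermx_eq0; apply/eqP/row_matrixP => i.
rewrite row0; set w := row i _.
have w0 : w *m gram^T = 0 by apply/sub_kermxP; exact: row_sub.
have : ip w^T w^T == 0.
  have e : gram *m w^T = (w *m gram^T)^T by rewrite trmx_mul trmxK.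
  by rewrite ip_gram -mulmxA e w0 trmx0 mulmx0 mxE.
by rewrite dnorm_eq0 => /eqP /(congr1 trmx); rewrite trmxK trmx0.
Qed.

Lemma adjmxP A u v : ip (A *m u) v = ip u (adjmx A *m v).
Proof.
rewrite !ip_gram /adjmx !trmx_mul !map_mxM !gram_herm.
have -> : ((A ^t conjC)^T) ^ conjC = A.
  by apply/matrixP => i j; rewrite !mxE; apply: conjCK.
rewrite trmx_inv map_invmx gram_herm !mulmxA.
by rewrite mulmxKV// gram_unit.
Qed.

Lemma ipVZ c mu lam : ipV (fun x y => c *: mu x y) (fun x y => c *: lam x y) =
  `|c| ^+ 2 * ipV mu lam.
Proof.
have e u w : ip (c *: u) w = c * ip u w by rewrite linearZl_LR.
rewrite /ipV !mulr_sumr; apply: eq_bigr => i _.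
rewrite mulr_sumr; apply: eq_bigr => j _.
rewrite mulr_sumr; apply: eq_bigr => k _.
by rewrite !e rmorphM normCK [LHS]mulrACA.
Qed.

Lemma actZ c g mu :
  act g (fun x y => c *: mu x y) = (fun x y => c *: act g mu x y).
Proof. by apply/funext=> x; apply/funext=> y; rewrite /act -scalemxAr. Qed.

Lemma rhoZ c g mu :
  rho (fun x y => c *: mu x y) g = complex.Re (`|c| ^+ 2) * rho mu g.
Proof.
rewrite /rho actZ ipVZ normc_def -rmorphXn /=.
by case: (ipV _ _) => a b /=; rewrite mul0r subr0.
Qed.

Lemma normV2Z c mu :
  normV2 (fun x y => c *: mu x y) = complex.Re (`|c| ^+ 2) * normV2 mu.
Proof.
rewrite /normV2 ipVZ normc_def -rmorphXn /=.
by case: (ipV _ _) => a b /=; rewrite mul0r subr0.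
Qed.

Lemma derive1Z (k : R) (f : R -> R) x : k != 0 ->
  derive1 (fun t => k * f t) x = k * derive1 f x.
Proof.
move=> k0; rewrite !derive1E.
have [df|ndf] := pselect (derivable f x 1).
  by rewrite -[RHS]/(k *: _) -deriveZ.
have ndkf : ~ derivable (fun t => k * f t) x 1.
  move=> /(@derivableZ _ _ _ _ k^-1) h; apply: ndf.
  suff -> : f = k^-1 \*: (fun t => k * f t) by [].
  by apply/funext => t /=; rewrite -[LHS]mul1r -(mulVf k0) -mulrA.
have d (h : R -> R) : ~ derivable h x 1 -> 'D_1 h x = 0 by move=> dh; exact: dvgP dh.
by rewrite (d _ ndkf) (d _ ndf) mulr0.
Qed.

(* Fn is thus well defined on the projective space. *)
Lemma FnZ c mu : c != 0 -> Fn (fun x y => c *: mu x y) = Fn mu.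
Proof.
move=> c0; have k0 : complex.Re (`|c| ^+ 2) != 0 :> R.
  rewrite normc_def -rmorphXn /= -(inj_eq (@complexI R)) rmorphXn /= -normc_def.
  by rewrite expf_eq0 normr_eq0.
suff E : is_moment (fun x y => c *: mu x y) = is_moment mu.
  by rewrite /Fn /moment E.
have D A : drho (fun x y => c *: mu x y) A / normV2 (fun x y => c *: mu x y) =
    drho mu A / normV2 mu.
  rewrite /drho normV2Z; under eq_fun do rewrite rhoZ.
  by rewrite derive1Z// -mulf_div divff// mul1r.
apply/funext => M; apply/propext; rewrite /is_moment.
by split=> -[? h]; split=> // A /h; rewrite D.
Qed.

End MomentMap.

(* Main.v *)
(** The bound [Fn <= 20] holds for every nonzero bilinear product, Leibniz or not.
    Choose an orthonormal basis [Y] in which the moment is diagonal, with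
    eigenvalues [a]. Pairing the moment with itself exhibits [\sum a^2] as the
    mean, for masses [|<mu(Y_i, Y_j), Y_k>|^2], of [2 (a_k - a_i - a_j)],
    that is, of twice the scalar product of [a] with the weight
    [e_k - e_i - e_j]. These weights have squared length at most 5, with equality
    exactly when [i = j] and [k <> i], whence [\sum a^2 <= 2 * sqrt (5 * \sum a^2)].
    In the equality case all weights of nonzero mass are equal to [a / 2], so the only
    nonzero coefficient is that of [Y_k] in [mu(Y_i, Y_i)] for one pair [k <> i].
    Conversely the products isomorphic to the model are
    [mu(x, y) = <x, w> <y, w> v] with [v] orthogonal to [w], and their moment is
    twice the orthogonal projection onto [v] minus four times that onto [w]. *)

From HB Require Import structures.
Require Import Defs.
From mathcomp Require Import all_boot all_order all_algebra.
From mathcomp Require Import fingroup perm sesquilinear spectral.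
From mathcomp Require Import complex.
From mathcomp Require Import all_classical all_reals all_analysis.
From mathcomp Require Import ring lra.
Import Order.TTheory GRing.Theory Num.Theory Num.Def.
Import numFieldNormedType.Exports.
Set Implicit Arguments.
Unset Strict Implicit.
Unset Printing Implicit Defensive.
Local Open Scope ring_scope.
Local Open Scope complex_scope.
Local Open Scope sesquilinear_scope.

(** * Squared modulus of a complex number, as a real number *)

Section NormSquared.
Variable R : realType.
Implicit Types (z w : R[i]) (x : R).

Definition sqn z : R := complex.Re z ^+ 2 + complex.Im z ^+ 2.

Lemma mul_conjC_sqn z : z * conjC z = (sqn z)%:C.
Proof.
case: z => a b; rewrite /sqn /= -[conjC _]/(conjc _) /=.
by apply/eqP; rewrite eq_complex /=; apply/andP; split; apply/eqP; ring.
Qed.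

Lemma sqn_ge0 z : 0 <= sqn z.
Proof. by rewrite addr_ge0 ?sqr_ge0. Qed.

Lemma sqn_eq0 z : (sqn z == 0) = (z == 0).
Proof.
case: z => a b; rewrite /sqn eq_complex /=.
by rewrite paddr_eq0 ?sqr_ge0// !sqrf_eq0.
Qed.

Lemma sqnM z w : sqn (z * w) = sqn z * sqn w.
Proof. by case: z w => a b [c d]; rewrite /sqn /=; ring. Qed.

Lemma sqn_real x : sqn x%:C = x ^+ 2.
Proof. by rewrite /sqn /=; ring. Qed.

Lemma conjC_realM x z : conjC (x%:C * z) = x%:C * conjC z.
Proof.
rewrite rmorphM; congr (_ * _).
by rewrite -[LHS]/(conjc _) /= oppr0.
Qed.

End NormSquared.

(** * Orthonormal bases and the spectral theorem for an arbitrary inner product *)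

Section OrthonormalBases.
Variables (R : realType) (n : nat).
Local Notation C := R[i].
Variable ip : {dot 'cV[C]_n for conjC}.
Implicit Types (x y u v w : 'cV[C]_n) (Y Z : 'I_n -> 'cV[C]_n) (A M : 'M[C]_n).

Definition onb Y := forall i j, ip (Y i) (Y j) = (i == j)%:R.

Lemma ipC u v : conjC (ip u v) = ip v u.
Proof. by rewrite [RHS]hermC /= expr0 mul1r. Qed.

Lemma ip_suml I (r : seq I) (P : pred I) (E : I -> 'cV[C]_n) v :
  ip (\sum_(i <- r | P i) E i) v = \sum_(i <- r | P i) ip (E i) v.
Proof. exact: linear_sumlz. Qed.

Lemma ip_sumr I (r : seq I) (P : pred I) (E : I -> 'cV[C]_n) v :
  ip v (\sum_(i <- r | P i) E i) = \sum_(i <- r | P i) ip v (E i).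
Proof. exact: linear_sumr. Qed.

Lemma ipDl u v w : ip (u + v) w = ip u w + ip v w.
Proof. exact: linearDl. Qed.

Lemma ipBl u v w : ip (u - v) w = ip u w - ip v w.
Proof. exact: linearBl. Qed.

Lemma ipBr u v w : ip u (v - w) = ip u v - ip u w.
Proof. exact: linearBr. Qed.

Lemma ip0l u : ip 0 u = 0.
Proof. exact: linear0l. Qed.

Lemma ipZl c u v : ip (c *: u) v = c * ip u v.
Proof. exact: linearZl_LR. Qed.

Lemma ipZr c u v : ip u (c *: v) = conjC c * ip u v.
Proof. exact: linearZr_LR. Qed.

Definition basis_mx Y : 'M[C]_n := \matrix_(i, j) Y j i 0.

Lemma col_basis_mx Y j : col j (basis_mx Y) = Y j.
Proof. by apply/matrixP => i k; rewrite !mxE ord1. Qed.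

(** Multiplying on the left by [(basis_mx Y) ^t conjC *m gram ip] computes coordinates in [Y]; for
    orthonormal [Y] this matrix is therefore the inverse of [basis_mx Y]. *)
Lemma mulmx_basis m (A : 'M[C]_(n, m)) Y i j : ((basis_mx Y) ^t conjC *m gram ip *m A) i j =
  ip (col j A) (Y i).
Proof.
rewrite ip_gram -[Y i]col_basis_mx mxE [RHS]mxE; apply: eq_bigr => k _.
congr (_ * _); last by rewrite mxE.
by rewrite !mxE; apply: eq_bigr => l _; rewrite !mxE.
Qed.

Lemma basis_mxKl Y : onb Y -> (basis_mx Y) ^t conjC *m gram ip *m basis_mx Y = 1%:M.
Proof.
by move=> hY; apply/matrixP => i j; rewrite mulmx_basis col_basis_mx hY mxE eq_sym.
Qed.

Lemma basis_mxKr Y : onb Y -> basis_mx Y *m ((basis_mx Y) ^t conjC *m gram ip) = 1%:M.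
Proof. by move=> hY; apply: mulmx1C; exact: basis_mxKl. Qed.

Lemma onb_expand Y x : onb Y -> x = \sum_i ip x (Y i) *: Y i.
Proof.
move=> hY; rewrite -[LHS]mul1mx -(basis_mxKr hY) -mulmxA.
apply/matrixP => k l; rewrite mxE summxE; apply: eq_bigr => i _.
rewrite [RHS]mxE mulrC; congr (_ * _); last by rewrite mxE ord1.
by rewrite ord1 mulmx_basis col_id.
Qed.

Lemma onb_eq Y x y : onb Y -> (forall i, ip x (Y i) = ip y (Y i)) -> x = y.
Proof.
move=> hY h; rewrite (onb_expand x hY) (onb_expand y hY).
by apply: eq_bigr => i _; rewrite h.
Qed.

Lemma onb_parseval Y u v : onb Y ->
  ip u v = \sum_i ip u (Y i) * conjC (ip v (Y i)).
Proof.
move=> hY; rewrite {1}(onb_expand v hY) ip_sumr.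
by apply: eq_bigr => i _; rewrite ipZr mulrC.
Qed.

Lemma onb_trace Y A : onb Y -> \tr A = \sum_i ip (A *m Y i) (Y i).
Proof.
move=> hY; rewrite -[in LHS](mulmx1 A) -(basis_mxKr hY) mulmxA mxtrace_mulC.
apply: eq_bigr => i _; rewrite mulmx_basis; congr (ip _ _).
by rewrite -(col_basis_mx Y i) !colE mulmxA.
Qed.

(** Both sides are the trace of the adjoint of [h] composed with [f]. It serves to change the basis
    in one argument of a product at a time. *)
Lemma sesqui_trace_onb (f h : {linear 'cV[C]_n -> 'cV[C]_n}) Y Z :
  onb Y -> onb Z ->
  \sum_i ip (f (Y i)) (h (Y i)) = \sum_i ip (f (Z i)) (h (Z i)).
Proof.
move=> hY hZ.
have E (k : {linear 'cV[C]_n -> 'cV[C]_n}) i :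
    k (Y i) = \sum_a ip (Y i) (Z a) *: k (Z a).
  by rewrite {1}(onb_expand (Y i) hZ) linear_sum; apply: eq_bigr => a _; rewrite linearZ.
transitivity (\sum_i \sum_a \sum_b
    ip (f (Z a)) (h (Z b)) * (ip (Y i) (Z a) * conjC (ip (Y i) (Z b)))).
  apply: eq_bigr => i _; rewrite (E f) ip_suml; apply: eq_bigr => a _.
  rewrite ipZl (E h) ip_sumr mulr_sumr; apply: eq_bigr => b _.
  by rewrite ipZr [RHS]mulrC mulrA.
(* With the sum over [i] innermost, Parseval in [Y] turns it into [ip (Z b) (Z a)], which leaves
   only [b = a]. *)
rewrite exchange_big; apply: eq_bigr => a _; rewrite exchange_big /=.
rewrite (bigD1 a)//= [X in _ + X]big1 ?addr0 => [|b ba]; rewrite -mulr_sumr.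
  rewrite -[RHS]mulr1; congr (_ * _).
  transitivity (ip (Z a) (Z a)); last by rewrite hZ eqxx.
  rewrite (onb_parseval _ _ hY); apply: eq_bigr => i _.
  by rewrite ipC mulrC ipC.
transitivity (ip (f (Z a)) (h (Z b)) * ip (Z b) (Z a)).
  congr (_ * _); rewrite (onb_parseval _ _ hY); apply: eq_bigr => i _.
  by rewrite ipC mulrC ipC.
by rewrite hZ (negPf ba) mulr0.
Qed.

Lemma orthonormal_onb (X : n.-tuple 'cV[C]_n) : orthonormal ip X -> onb (tnth X).
Proof.
move=> hX i j; have x0 := tnth X i.
move/orthonormalP: (hX) => [uX h]; rewrite h ?mem_tnth//.
by rewrite !(tnth_nth x0) nth_uniq ?size_tuple.
Qed.

(** In an orthonormal basis a selfadjoint operator has a Hermitian matrix [B], to which the spectral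
    theorem for the standard inner product applies; the columns of the unitary [V] are the
    coordinates of the eigenvectors. *)
Lemma selfadjoint_spectral A Y : onb Y -> selfadjoint ip A ->
  exists Z (a : 'I_n -> R), onb Z /\ forall i, A *m Z i = (a i)%:C *: Z i.
Proof.
move=> hY sA.
pose B : 'M[C]_n := \matrix_(i, j) ip (A *m Y j) (Y i).
have hB : B \is hermsymmx.
  apply/is_hermitianmxP; rewrite expr0 scale1r; apply/matrixP => i j.
  by rewrite !mxE ipC adjmxP sA.
have := orthomx_spectralP (hermitian_normalmx hB).
set U := spectralmx B; set d := spectral_diag B => eB.
have uU : U \is unitarymx by exact: spectral_unitarymx.
pose V := invmx U.
have BV : B *m V = V *m diag_mx d.
  by rewrite eB mulmxK ?unitarymx_unit.
have VV : V ^t* *m V = 1%:M.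
  by rewrite /V invmx_unitary// trmxCK; apply/unitarymxP.
pose Z j := \sum_i V i j *: Y i.
have d_real i : exists r : R, d 0 i = r%:C.
  have /mxOverP/(_ 0 i) := hermitian_spectral_diag_real hB.
  rewrite -/d => /CrealP; case: (d 0 i) => x y [] e; exists x; congr (_ +i* _).
  by move: e; lra.
have [a ha] := choice d_real.
exists Z, a; split=> [i j|j].
  transitivity ((V ^t* *m V) j i); last by rewrite VV mxE eq_sym.
  rewrite /Z ip_suml mxE; apply: eq_bigr => k _.
  rewrite ipZl ip_sumr (bigD1 k)//= big1 => [|l lk].
    by rewrite ipZr hY eqxx mulr1 addr0 !mxE mulrC.
  by rewrite ipZr hY eq_sym (negPf lk) mulr0.
rewrite -ha /Z mulmx_sumr scaler_sumr.
transitivity (\sum_i (B *m V) i j *: Y i).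
  transitivity (\sum_k \sum_i (B i k * V k j) *: Y i).
    apply: eq_bigr => k _; rewrite -scalemxAr (onb_expand (A *m Y k) hY) scaler_sumr.
    by apply: eq_bigr => i _; rewrite scalerA mulrC mxE.
  rewrite exchange_big; apply: eq_bigr => i _.
  by rewrite -scaler_suml mxE.
by apply: eq_bigr => i _; rewrite BV mul_mx_diag mxE scalerA mulrC.
Qed.

End OrthonormalBases.

(** * Bilinearity of the transformed products *)

Section ActBilinear.
Variables (R : realType) (n : nat).
Local Notation C := R[i].
Variables (g : 'M[C]_n) (mu : {bilinear 'cV[C]_n -> 'cV[C]_n -> 'cV[C]_n}).

Fact act_is_bilinear : bilinear_for
  (GRing.Scale.Law.clone _ _ *:%R _) (GRing.Scale.Law.clone _ _ *:%R _) (act g mu).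
Proof.
split=> z a x y; rewrite /act mulmxDr -scalemxAr.
  by rewrite linearPl mulmxDr -scalemxAr.
by rewrite linearPr mulmxDr -scalemxAr.
Qed.

HB.instance Definition _ := bilinear_isBilinear.Build C 'cV[C]_n 'cV[C]_n 'cV[C]_n
  *:%R *:%R (act g mu) act_is_bilinear.

End ActBilinear.

(** * Derivatives of the scaling factors along the curve 1 + t A *)

Section Derivative.
Variable R : realType.
Implicit Types a b c t : R.

Lemma is_derive_affine a : is_derive (0 : R) 1 (fun t => 1 + t * a) a.
Proof.
have -> : (fun t => 1 + t * a) = cst 1 + (a \*: (id : R -> R)).
  by apply/funext => t; rewrite /= !fctE /= [a *: t]mulrC.
by apply: is_derive_eq; rewrite add0r [_ *: _]mulr1.
Qed.

Lemma is_derive_inv_affine a : is_derive (0 : R) 1 (fun t => (1 + t * a)^-1) (- a).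
Proof.
have [d e] := is_derive_affine a.
have u0 : 1 + 0 * a != 0 by rewrite mul0r addr0 oner_eq0.
apply: DeriveDef; first exact: derivableV.
by rewrite deriveV// e mul0r addr0 expr1n invr1 scaleN1r.
Qed.

(** For diagonal A with eigenvalues [a], [b] on the inputs and [c] on the output, this is the factor
    by which 1 + t A multiplies a squared coefficient. *)
Lemma is_derive_weight a b c : is_derive (0 : R) 1
  (fun t => ((1 + t * c) * ((1 + t * a)^-1 * (1 + t * b)^-1)) ^+ 2)
  (2 * (c - a - b)).
Proof.
have da := is_derive_inv_affine a; have db := is_derive_inv_affine b.
have dc := is_derive_affine c.
pose f := (fun t => 1 + t * c) * ((fun t => (1 + t * a)^-1) * (fun t => (1 + t * b)^-1)).
rewrite -[X in is_derive _ _ X]/(f ^+ 2).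
apply: is_derive_eq; rewrite /f !fctE /= !mul0r !addr0 invr1.
rewrite /GRing.scale /=; ring.
Qed.

End Derivative.

(** * The differential of [rho] in an eigenbasis of the direction *)

Section Differential.
Variables (R : realType) (n : nat).
Local Notation C := R[i].
Variable ip : {dot 'cV[C]_n for conjC}.
Variable mu : {bilinear 'cV[C]_n -> 'cV[C]_n -> 'cV[C]_n}.
Variables (X : n.-tuple 'cV[C]_n) (Y : 'I_n -> 'cV[C]_n).
Hypotheses (hX : onb ip (tnth X)) (hY : onb ip Y).

Definition coef2 (nu : product R n) i j k : R := sqn (ip (nu (Y i) (Y j)) (Y k)).

(** [X] is replaced by [Y] slot by slot: Parseval handles the output, [sesqui_trace_onb] each of the
    two inputs. *)
Lemma ipV_onb (nu : {bilinear 'cV[C]_n -> 'cV[C]_n -> 'cV[C]_n}) :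
  ipV ip X nu nu = (\sum_i \sum_j \sum_k coef2 nu i j k)%:C.
Proof.
transitivity (\sum_i \sum_j ip (nu (Y i) (Y j)) (nu (Y i) (Y j))); last first.
  rewrite rmorph_sum; apply: eq_bigr => i _; rewrite rmorph_sum; apply: eq_bigr => j _.
  rewrite rmorph_sum (onb_parseval _ _ hY); apply: eq_bigr => k _.
  exact: mul_conjC_sqn.
transitivity (\sum_i \sum_j ip (nu (tnth X i) (Y j)) (nu (tnth X i) (Y j))).
  apply: eq_bigr => i _.
  rewrite -(sesqui_trace_onb (nu (tnth X i)) (nu (tnth X i)) hX hY).
  by apply: eq_bigr => j _; rewrite (onb_parseval _ _ hX).
rewrite exchange_big [RHS]exchange_big; apply: eq_bigr => j _.
exact: (sesqui_trace_onb (applyr nu (Y j)) (applyr nu (Y j)) hX hY).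
Qed.

Lemma normV2_onb : normV2 ip X mu = \sum_i \sum_j \sum_k coef2 mu i j k.
Proof. by rewrite /normV2 ipV_onb. Qed.

Variables (A : 'M[C]_n) (a : 'I_n -> R).
Hypothesis AY : forall i, A *m Y i = (a i)%:C *: Y i.

Lemma ip_eigen z k : ip (A *m z) (Y k) = (a k)%:C * ip z (Y k).
Proof.
rewrite {1}(onb_expand z hY) mulmx_sumr ip_suml (bigD1 k)//= big1 => [|i ik].
  by rewrite -scalemxAr AY !ipZl hY eqxx mulr1 addr0 mulrC.
by rewrite -scalemxAr AY !ipZl hY (negPf ik) !mulr0.
Qed.

Lemma ip_curve t z k :
  ip ((1%:M + t%:C *: A) *m z) (Y k) = (1 + t * a k)%:C * ip z (Y k).
Proof.
rewrite mulmxDl mul1mx ipDl -scalemxAl ipZl ip_eigen mulrA.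
by rewrite rmorphD rmorphM rmorph1 mulrDl mul1r.
Qed.

Lemma curve_eigen t i : (1%:M + t%:C *: A) *m Y i = (1 + t * a i)%:C *: Y i.
Proof.
apply: (onb_eq hY) => k; rewrite ip_curve ipZl hY.
by have [->|_] := eqVneq i k; rewrite ?mulr0.
Qed.

Lemma curve_inv t i : (forall k, 1 + t * a k != 0) ->
  invmx (1%:M + t%:C *: A) *m Y i = ((1 + t * a i)^-1)%:C *: Y i.
Proof.
move=> h; set g := _ + _.
(* A vector killed by [g] has zero coordinates in [Y], since [g] multiplies them by the nonzero
   factors [1 + t * a k]. *)
have gu : g \in unitmx.
  rewrite -unitmx_tr -row_free_unit -kermx_eq0; apply/eqP/row_matrixP => l.
  rewrite row0; set w := row l _.
  have w0 : w *m g^T = 0 by apply/sub_kermxP; exact: row_sub.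
  have gw : g *m w^T = 0 by rewrite -(trmxK g) -trmx_mul w0 trmx0.
  apply: trmx_inj; rewrite trmx0; apply: (onb_eq hY) => k.
  apply: (mulfI (x := (1 + t * a k)%:C)); first by rewrite fmorph_eq0.
  by rewrite -ip_curve -/g gw ip0l mulr0.
have c0 : (1 + t * a i)%:C != 0 by rewrite fmorph_eq0.
rewrite fmorphV -[X in invmx g *m X](scalerK c0) -curve_eigen -/g.
by rewrite -scalemxAr mulmxA mulVmx// mul1mx.
Qed.

Lemma rho_curve t : (forall k, 1 + t * a k != 0) ->
  rho ip X mu (1%:M + t%:C *: A) = \sum_i \sum_j \sum_k coef2 mu i j k *
    ((1 + t * a k) * ((1 + t * a i)^-1 * (1 + t * a j)^-1)) ^+ 2.
Proof.
move=> h; rewrite /rho ipV_onb /=.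
apply: eq_bigr => i _; apply: eq_bigr => j _; apply: eq_bigr => k _.
rewrite /coef2 /act !curve_inv// ip_curve linearZl_LR linearZr_LR !ipZl.
by rewrite !sqnM !sqn_real; ring.
Qed.

(** The formula of [rho_curve] is differentiated term by term. It holds only where no [1 + t * a k]
    vanishes, but this is a neighbourhood of 0, as there are finitely many [k]. *)
Lemma drho_eigen : drho ip X mu A = \sum_i \sum_j \sum_k coef2 mu i j k *
  (2 * (a k - a i - a j)).
Proof.
rewrite /drho derive1E.
pose F i j k : R -> R := coef2 mu i j k \*:
  (fun t => ((1 + t * a k) * ((1 + t * a i)^-1 * (1 + t * a j)^-1)) ^+ 2).
have dF : is_derive (0 : R) 1 (\sum_i \sum_j \sum_k F i j k)
    (\sum_i \sum_j \sum_k coef2 mu i j k * (2 * (a k - a i - a j))).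
  do 3!(apply: is_derive_sum => ?).
  by apply: is_deriveZ; exact: is_derive_weight.
rewrite -[RHS](@derive_val _ _ _ _ _ _ _ dF); apply: near_eq_derive.
have : \forall t \near (0 : R), forall k, 1 + t * a k != 0.
  have := @filter_forall R 'I_n (fun k t => 1 + t * a k != 0) (nbhs (0 : R)) _.
  apply=> k.
  have [/derivable1_diffP/differentiable_continuous d _] := is_derive_affine (a k).
  by apply: (cvgr_neq0 _ d); rewrite mul0r addr0 oner_eq0.
apply: filterS => t h; rewrite rho_curve// !fct_sumE.
apply: eq_bigr => i _; rewrite fct_sumE; apply: eq_bigr => j _.
by rewrite fct_sumE.
Qed.

End Differential.

(** * Weights of the coefficients and the bound on their mean *)

Section Weights.
Variables (R : realType) (n : nat).
Implicit Types (i j k p : 'I_n) (a f : 'I_n -> R).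

Definition weight i j k p : R := (p == k)%:R - (p == i)%:R - (p == j)%:R.

Lemma sum_weight i j k f : \sum_p weight i j k p * f p = f k - f i - f j.
Proof.
have E m : \sum_p (p == m)%:R * f p = f m.
  rewrite (bigD1 m)//= eqxx mul1r big1 ?addr0// => p pm.
  by rewrite (negPf pm) mul0r.
under eq_bigr do rewrite !mulrBl.
by rewrite !sumrB !E.
Qed.

Lemma sum_weight_sqr i j k : \sum_p weight i j k p ^+ 2 =
  3 + 2 * ((i == j)%:R - (k == i)%:R - (k == j)%:R).
Proof.
under eq_bigr do rewrite expr2.
rewrite sum_weight /weight !eqxx (eq_sym j i) (eq_sym i k) (eq_sym j k).
by rewrite !mulr1n; lra.
Qed.

(** The squared length is 5 in the stated case, 3 when the three indices are distinct, and 1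
    otherwise. *)
Lemma sum_weight_sqr_le5 i j k : \sum_p weight i j k p ^+ 2 <= 5
  ?= iff (i == j) && (k != i).
Proof.
rewrite sum_weight_sqr; split.
  by do 3 case: eqP => _; rewrite /= ?mulr1n ?mulr0n; lra.
have [<-|_] := eqVneq i j; have [_|_] := eqVneq k i; try have [_|_] := eqVneq k j;
  rewrite /= ?mulr1n ?mulr0n.
all: by [apply/eqP; lra | apply/negbTE/eqP => h; lra].
Qed.

(* With [s = \sum a^2] and [l = a_k - a_i - a_j], the bound [l <= sqrt (5 s)] is
   used in the form [2 l <= s / 2 + 10], tight at [s = 20]. *)
Lemma weight_slack a i j k :
  (\sum_p a p ^+ 2) / 2 + 10 - 2 * (a k - a i - a j) =
  (\sum_p (a p - 2 * weight i j k p) ^+ 2) / 2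
    + 2 * (5 - \sum_p weight i j k p ^+ 2).
Proof.
have -> : \sum_p (a p - 2 * weight i j k p) ^+ 2 = \sum_p a p ^+ 2
    - 4 * (a k - a i - a j) + 4 * \sum_p weight i j k p ^+ 2.
  rewrite -sum_weight !mulr_sumr -sumrB -big_split; apply: eq_bigr => p _ /=.
  by ring.
by lra.
Qed.

Lemma weight_slack_ge0 a i j k :
  0 <= (\sum_p a p ^+ 2) / 2 + 10 - 2 * (a k - a i - a j).
Proof.
rewrite weight_slack; have [h _] := sum_weight_sqr_le5 i j k.
have : 0 <= \sum_p (a p - 2 * weight i j k p) ^+ 2.
  by apply: sumr_ge0 => p _; exact: sqr_ge0.
by move: h; lra.
Qed.

(** By [weight_slack] the slack is a sum of two nonnegative terms, so both vanish: one gives the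
    equality case of [sum_weight_sqr_le5], the other determines [a]. *)
Lemma weight_slack_eq0 a i j k :
  (\sum_p a p ^+ 2) / 2 + 10 - 2 * (a k - a i - a j) = 0 ->
  [/\ i = j, k != i & forall p, a p = 2 * weight i j k p].
Proof.
rewrite weight_slack; have [h e] := sum_weight_sqr_le5 i j k.
have h0 : 0 <= \sum_p (a p - 2 * weight i j k p) ^+ 2.
  by apply: sumr_ge0 => p _; exact: sqr_ge0.
move=> E; have e0 : \sum_p (a p - 2 * weight i j k p) ^+ 2 = 0.
  by move: h h0 E; lra.
have : \sum_p weight i j k p ^+ 2 == 5 by apply/eqP; move: h h0 E; lra.
rewrite e => /andP[/eqP ij ki]; split=> // p.
have /(_ p isT)/eqP := psumr_eq0P (fun p _ => sqr_ge0 _) e0.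
by rewrite sqrf_eq0 subr_eq0 => /eqP.
Qed.

Variables (c : 'I_n -> 'I_n -> 'I_n -> R) (a : 'I_n -> R).
Hypothesis c_ge0 : forall i j k, 0 <= c i j k.
Hypothesis c_sum : 0 < \sum_i \sum_j \sum_k c i j k.
Hypothesis mean : (\sum_p a p ^+ 2) * (\sum_i \sum_j \sum_k c i j k) =
  \sum_i \sum_j \sum_k c i j k * (2 * (a k - a i - a j)).

Let slack i j k := c i j k * ((\sum_p a p ^+ 2) / 2 + 10 - 2 * (a k - a i - a j)).

Let slack_ge0 i j k : 0 <= slack i j k.
Proof. by rewrite mulr_ge0// weight_slack_ge0. Qed.

Let sum_slack : \sum_i \sum_j \sum_k slack i j k =
  (10 - (\sum_p a p ^+ 2) / 2) * \sum_i \sum_j \sum_k c i j k.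
Proof.
transitivity (((\sum_p a p ^+ 2) / 2 + 10) * (\sum_i \sum_j \sum_k c i j k)
    - \sum_i \sum_j \sum_k c i j k * (2 * (a k - a i - a j))).
  rewrite mulr_sumr -sumrB; apply: eq_bigr => i _.
  rewrite mulr_sumr -sumrB; apply: eq_bigr => j _.
  rewrite mulr_sumr -sumrB; apply: eq_bigr => k _.
  by rewrite /slack; ring.
by rewrite -mean; field.
Qed.

(** The nonnegative slacks, weighted by the masses, add up to [10 - s / 2] times the positive total
    mass, where [s] is the sum of the [a p ^+ 2]. *)
Lemma sqr_mean_weight_le20 : \sum_p a p ^+ 2 <= 20.
Proof.
have : 0 <= \sum_i \sum_j \sum_k slack i j k by do 3!(apply: sumr_ge0 => ? _).
by rewrite sum_slack pmulr_lge0//; lra.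
Qed.

(** At 20 the weighted slacks add up to 0, so each of them vanishes, and every triple of nonzero
    mass falls under [weight_slack_eq0]. *)
Lemma sqr_mean_weight_eq20 : \sum_p a p ^+ 2 = 20 ->
  exists i k, k != i /\
    forall i' j' k', c i' j' k' != 0 -> [/\ i' = i, j' = i & k' = k].
Proof.
move=> s20.
have s0 i j k : slack i j k = 0.
  have E : \sum_i \sum_j \sum_k slack i j k = 0 by rewrite sum_slack s20; field.
  have {}E := psumr_eq0P (fun i _ => sumr_ge0 _ (fun j _ => sumr_ge0 _
    (fun k _ => slack_ge0 i j k))) E.
  have {}E := psumr_eq0P (fun j _ => sumr_ge0 _
    (fun k _ => slack_ge0 i j k)) (E i isT).
  exact: (psumr_eq0P (fun k _ => slack_ge0 i j k) (E j isT)).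
have H i j k : c i j k != 0 -> [/\ i = j, k != i & forall p, a p = 2 * weight i j k p].
  move=> c0; apply: weight_slack_eq0; apply/eqP.
  by have /eqP := s0 i j k; rewrite mulf_eq0 (negPf c0).
have [i [j [k cn0]]] : exists i j k, c i j k != 0.
  apply: contrapT => no; move: c_sum; rewrite big1 ?ltxx// => i _.
  rewrite big1// => j _; rewrite big1// => k _; apply: contrapT => /eqP ?.
  by apply: no; exists i, j, k.
have [<- ki aw] := H _ _ _ cn0; exists i, k; split=> // i' j' k'.
move=> /H [<- ki' aw'].
have E p : weight i i k p = weight i' i' k' p.
  by apply: (mulfI (x := 2)) => //; rewrite -aw -aw'.
(* The common weight is -2 exactly at [i] and 1 exactly at [k], so it determines both indices. *)
have := E i; have := E k; rewrite /weight !eqxx (negPf ki) (eq_sym i k) (negPf ki).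
have [->|_] := eqVneq i i'; have [->|_] := eqVneq k k' => //;
  rewrite ?eqxx ?mulr1n ?mulr0n; do ?case: eqP => _; rewrite /= ?mulr1n ?mulr0n;
  try by lra.
Qed.

End Weights.

(** * The bound 20 for [Fn] and its equality case *)

Section Moment.
Variables (R : realType) (n : nat).
Local Notation C := R[i].
Variable ip : {dot 'cV[C]_n for conjC}.
Variable mu : {bilinear 'cV[C]_n -> 'cV[C]_n -> 'cV[C]_n}.
Variables (X : n.-tuple 'cV[C]_n).
Hypothesis hX : onb ip (tnth X).

Lemma bilinear_onb (Y : 'I_n -> 'cV[C]_n) x y : onb ip Y ->
  mu x y = \sum_i \sum_j (ip x (Y i) * ip y (Y j)) *: mu (Y i) (Y j).
Proof.
move=> hY; rewrite {1}(onb_expand x hY) {1}(onb_expand y hY).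
rewrite linear_sumlz; apply: eq_bigr => i _.
rewrite linear_sumr; apply: eq_bigr => j _.
by rewrite linearZl_LR linearZr_LR scalerA.
Qed.

Lemma coef2_eq0 (Y : 'I_n -> 'cV[C]_n) i j : onb ip Y ->
  (forall k, coef2 ip Y mu i j k = 0) -> mu (Y i) (Y j) = 0.
Proof.
move=> hY h; apply: (onb_eq hY) => k; rewrite ip0l.
by have /eqP := h k; rewrite sqn_eq0 => /eqP.
Qed.

Lemma normV2_gt0 : (mu : product R n) <> trivial_alg (n := n) -> 0 < normV2 ip X mu.
Proof.
move=> mu0.
have ge0 : 0 <= normV2 ip X mu.
  by rewrite (normV2_onb mu hX hX); do 3!(apply: sumr_ge0 => ? _); exact: sqn_ge0.
rewrite lt_neqAle ge0 andbT eq_sym; apply/eqP => N0; apply: mu0.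
have Z i j : mu (tnth X i) (tnth X j) = 0.
  move: N0; rewrite (normV2_onb mu hX hX) => E.
  have {}E := psumr_eq0P (fun i _ => sumr_ge0 _ (fun j _ => sumr_ge0 _
    (fun k _ => sqn_ge0 _))) E.
  have {}E := psumr_eq0P (fun j _ => sumr_ge0 _ (fun k _ => sqn_ge0 _)) (E i isT).
  apply: (coef2_eq0 hX) => k.
  exact: (psumr_eq0P (fun k _ => sqn_ge0 _) (E j isT)).
apply/funext => x; apply/funext => y; rewrite (bilinear_onb x y hX).
by rewrite big1 // => i _; rewrite big1 // => j _; rewrite Z scaler0.
Qed.

Lemma ipM_selfadjoint (A B : 'M[C]_n) : selfadjoint ip B -> ipM ip A B = \tr (A *m B).
Proof. by rewrite /ipM => ->. Qed.

Lemma ipM_eigen (M : 'M[C]_n) Y (a : 'I_n -> R) : onb ip Y -> selfadjoint ip M ->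
  (forall i, M *m Y i = (a i)%:C *: Y i) -> ipM ip M M = (\sum_i a i ^+ 2)%:C.
Proof.
move=> hY sM MY; rewrite ipM_selfadjoint// (onb_trace _ hY) rmorph_sum.
apply: eq_bigr => i _; rewrite -mulmxA MY -scalemxAr MY scalerA ipZl hY eqxx mulr1.
by rewrite expr2 rmorphM.
Qed.

(** This is the defining identity of the moment tested in the direction [M] itself, with [drho] and
    the norm computed in its eigenbasis [Y]. *)
Lemma is_moment_mean (M : 'M[C]_n) Y (a : 'I_n -> R) :
  0 < normV2 ip X mu -> onb ip Y -> is_moment ip X mu M ->
  (forall i, M *m Y i = (a i)%:C *: Y i) ->
  (\sum_i a i ^+ 2) * (\sum_i \sum_j \sum_k coef2 ip Y mu i j k) =
  \sum_i \sum_j \sum_k coef2 ip Y mu i j k * (2 * (a k - a i - a j)).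
Proof.
move=> N0 hY [sM mM] MY; rewrite -(drho_eigen mu hX hY MY) -(normV2_onb mu hX hY).
have := mM M sM; rewrite (ipM_eigen hY sM MY) => /complexI ->.
by rewrite divfK// gt_eqF.
Qed.

(* [moment] defaults to [0] where no moment exists; the bound holds in that case too,
   so the existence of moments is only needed for the model products. *)
Lemma Fn_cases : Fn ip X mu = 0 \/
  exists2 M, is_moment ip X mu M & (Fn ip X mu)%:C = ipM ip M M.
Proof.
have [[M hM]|no] := pselect (exists M, is_moment ip X mu M).
  right; exists (moment ip X mu); first exact: (xgetI _ hM).
  have [sM _] := xgetI (0 : 'M[C]_n) hM.
  have [Y [a [hY MY]]] := selfadjoint_spectral hX sM.
  by rewrite /Fn /moment (ipM_eigen hY sM MY).
left; rewrite /Fn /moment xgetPN => [|M hM]; last by apply: no; exists M.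
by rewrite /ipM mul0mx mxtrace0.
Qed.

Lemma Fn_le20 : (mu : product R n) <> trivial_alg (n := n) -> Fn ip X mu <= 20.
Proof.
move=> /normV2_gt0 N0; have [->//|[M mM]] := Fn_cases.
have [sM _] := mM; have [Y [a [hY MY]]] := selfadjoint_spectral hX sM.
rewrite (ipM_eigen hY sM MY) => /complexI ->.
apply: sqr_mean_weight_le20 (is_moment_mean N0 hY mM MY).
- by move=> *; exact: sqn_ge0.
- by rewrite -(normV2_onb mu hX hY).
Qed.

(** The only nonzero mass is at [(i, i, k)]. The scalar [c] stays apart because [Y] is orthonormal;
    it is absorbed later by a non-unitary isomorphism. *)
Lemma Fn_eq20 : (mu : product R n) <> trivial_alg (n := n) -> Fn ip X mu = 20 ->
  exists Y i k c, [/\ onb ip Y, k != i, c != 0 &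
    forall x y, mu x y = (ip x (Y i) * ip y (Y i)) *: (c *: Y k)].
Proof.
move=> mu0 F20; have N0 := normV2_gt0 mu0.
have [F0|[M mM]] := Fn_cases; first by move: F20; rewrite F0; lra.
have [sM _] := mM; have [Y [a [hY MY]]] := selfadjoint_spectral hX sM.
rewrite F20 (ipM_eigen hY sM MY) => /complexI/esym s20.
have c_ge0 i j k : 0 <= coef2 ip Y mu i j k by exact: sqn_ge0.
have c_sum : 0 < \sum_i \sum_j \sum_k coef2 ip Y mu i j k.
  by rewrite -(normV2_onb mu hX hY).
have [i [k [ki H]]] :=
  sqr_mean_weight_eq20 c_ge0 c_sum (is_moment_mean N0 hY mM MY) s20.
have mu_ii : mu (Y i) (Y i) = ip (mu (Y i) (Y i)) (Y k) *: Y k.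
  apply: (onb_eq hY) => l; rewrite ipZl hY.
  have [<-|kl] := eqVneq k l; first by rewrite mulr1.
  rewrite mulr0; apply/eqP; rewrite -sqn_eq0; apply: contraT => /H[_ _ lk].
  by rewrite lk eqxx in kl.
have E x y : mu x y = (ip x (Y i) * ip y (Y i)) *: mu (Y i) (Y i).
  rewrite (bilinear_onb x y hY) (bigD1 i)//= (bigD1 i)//= [X in _ + X + _]big1 => [|j ji].
    rewrite big1 ?addr0// => l li; rewrite big1// => j _.
    rewrite (coef2_eq0 hY) ?scaler0// => m; apply/eqP; apply: contraT => /H[] /eqP.
    by rewrite (negPf li).
  rewrite (coef2_eq0 hY) ?scaler0// => m; apply/eqP; apply: contraT => /H[] _ /eqP.
  by rewrite (negPf ji).
exists Y, i, k, (ip (mu (Y i) (Y i)) (Y k)); split=> //; last by rewrite -mu_ii.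
apply/eqP => c0; apply: mu0; apply/funext => x; apply/funext => y.
by rewrite E mu_ii c0 scale0r scaler0.
Qed.

End Moment.

(** * Moments of the products with a one-dimensional image spanned by [v] *)

Section RankOne.
Variables (R : realType) (n : nat).
Local Notation C := R[i].
Variable ip : {dot 'cV[C]_n for conjC}.
Implicit Types (v w : 'cV[C]_n).

Definition rank_one_mx v w : 'M[C]_n := v *m (w ^t conjC *m gram ip).

Lemma rank_one_mxE v w x : rank_one_mx v w *m x = ip x w *: v.
Proof.
rewrite /rank_one_mx -mulmxA [w ^t conjC *m gram ip *m x]mx11_scalar -ip_gram.
exact: mul_mx_scalar.
Qed.

Lemma mxtrace_rank_one v w (A : 'M[C]_n) : \tr (rank_one_mx v w *m A) = ip (A *m v) w.
Proof.
by rewrite /rank_one_mx -mulmxA mxtrace_mulC trace_mx11 ip_gram !mulmxA.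
Qed.

Lemma selfadjointP (X : 'I_n -> 'cV[C]_n) (A : 'M[C]_n) : onb ip X ->
  (forall x y, ip (A *m x) y = ip x (A *m y)) -> selfadjoint ip A.
Proof.
move=> hX h; rewrite /selfadjoint -[LHS]mulmx1 -[RHS]mulmx1 -(basis_mxKr hX) !mulmxA.
congr (_ *m _); congr (_ *m _); apply/matrixP => i j.
have /matrixP/(_ i 0) : adjmx ip A *m X j = A *m X j.
  apply: (onb_eq hX) => k; rewrite -[LHS]ipC -[RHS]ipC; congr conjC.
  by rewrite -adjmxP h.
by rewrite -(col_basis_mx X j) !colE !mulmxA -!colE !mxE.
Qed.

Variable mu : {bilinear 'cV[C]_n -> 'cV[C]_n -> 'cV[C]_n}.
Variables (X : n.-tuple 'cV[C]_n) (v w : 'cV[C]_n).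
Hypothesis hX : onb ip (tnth X).
Hypotheses (v0 : v != 0) (w0 : w != 0) (vw : ip v w = 0).
Hypothesis muE : forall x y, mu x y = (ip x w * ip y w) *: v.

(** The basis is a parameter so that the same squared length can be recomputed in an eigenbasis of
    the direction. *)
Let sq (Y : 'I_n -> 'cV[C]_n) (u : 'cV[C]_n) : R := \sum_i sqn (ip u (Y i)).

Let sqE Y u : onb ip Y -> ip u u = (sq Y u)%:C.
Proof.
move=> hY; rewrite (onb_parseval _ _ hY) rmorph_sum.
by apply: eq_bigr => i _; exact: mul_conjC_sqn.
Qed.

Let sq_eq0 Y u : onb ip Y -> u != 0 -> sq Y u != 0.
Proof.
by move=> hY; apply: contraNneq => e; rewrite -(dnorm_eq0 ip) (sqE _ hY) e.
Qed.

Let V := sq (tnth X) v.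
Let W := sq (tnth X) w.

(** [v] and [w] need not be unit vectors: dividing by [V] and [W] makes the rank one operators
    orthogonal projections. *)
Definition rank_one_moment : 'M[C]_n :=
  (2 / V)%:C *: rank_one_mx v v - (4 / W)%:C *: rank_one_mx w w.

Let mxtrace_combination (a b : C) (P Q : 'M[C]_n) :
  \tr (a *: P - b *: Q) = a * \tr P - b * \tr Q.
Proof. by rewrite raddfB /= !mxtraceZ. Qed.

Let mulmx_combination (a b : C) (P Q : 'M[C]_n) m (B : 'M[C]_(n, m)) :
  (a *: P - b *: Q) *m B = a *: (P *m B) - b *: (Q *m B).
Proof. by rewrite mulmxBl !scalemxAl. Qed.

Lemma rank_one_momentE x : rank_one_moment *m x =
  ((2 / V)%:C * ip x v) *: v - ((4 / W)%:C * ip x w) *: w.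
Proof.
rewrite /rank_one_moment mulmx_combination.
by congr (_ - _); rewrite -scalerA; congr (_ *: _); exact: rank_one_mxE.
Qed.

Lemma mxtrace_rank_one_moment A : \tr (rank_one_moment *m A) =
  (2 / V)%:C * ip (A *m v) v - (4 / W)%:C * ip (A *m w) w.
Proof.
rewrite /rank_one_moment mulmx_combination.
by rewrite mxtrace_combination; congr (_ * _ - _ * _); exact: mxtrace_rank_one.
Qed.

(** In an eigenbasis of [A] the masses are products of one factor per index, so all sums factor;
    both sides become 2 [Sv] / [V] - 4 [Sw] / [W]. *)
Lemma rank_one_is_moment : is_moment ip X mu rank_one_moment.
Proof.
split.
  apply: (selfadjointP hX) => x y.
  rewrite !rank_one_momentE ipBl ipBr !ipZl !ipZr.
  by rewrite !conjC_realM !ipC; congr (_ - _); exact: mulrAC.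
move=> A sA; have [Y [a [hY AY]]] := selfadjoint_spectral hX sA.
rewrite ipM_selfadjoint// mxtrace_rank_one_moment.
have VY : V = sq Y v by apply: complexI; rewrite -!sqE.
have WY : W = sq Y w by apply: complexI; rewrite -!sqE.
have ipA u : ip (A *m u) u = (\sum_i a i * sqn (ip u (Y i)))%:C.
  rewrite (onb_parseval _ _ hY) rmorph_sum; apply: eq_bigr => i _.
  by rewrite (ip_eigen hY AY) -mulrA mul_conjC_sqn -rmorphM.
rewrite !ipA -!rmorphM -rmorphB; congr (_ %:C).
have cE i j k : coef2 ip Y mu i j k =
    sqn (ip w (Y i)) * sqn (ip w (Y j)) * sqn (ip v (Y k)).
  have sC (z : C) : sqn (conjC z) = sqn z.
    by apply: complexI; rewrite -!mul_conjC_sqn conjCK mulrC.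
  by rewrite /coef2 muE ipZl !sqnM -(sC (ip w (Y i))) -(sC (ip w (Y j))) !ipC.
rewrite (drho_eigen mu hX hY AY) (normV2_onb mu hX hY).
have [V0 W0] : V != 0 /\ W != 0 by split; [exact: (sq_eq0 hX v0)|exact: (sq_eq0 hX w0)].
set Sv := \sum_i a i * sqn (ip v _); set Sw := \sum_i a i * sqn (ip w _).
have -> : \sum_i \sum_j \sum_k coef2 ip Y mu i j k = W * W * V.
  rewrite WY VY /sq !mulr_suml; apply: eq_bigr => i _.
  rewrite -mulrA mulr_suml mulr_sumr; apply: eq_bigr => j _.
  by rewrite !mulr_sumr; apply: eq_bigr => k _; rewrite cE mulrA.
have -> : \sum_i \sum_j \sum_k coef2 ip Y mu i j k * (2 * (a k - a i - a j)) =
    2 * (W * W * Sv - 2 * (W * V * Sw)).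
  transitivity (2 * (W * (W * Sv) - Sw * (W * V) - W * (Sw * V))); last by ring.
  rewrite WY VY /sq /Sv /Sw !mulr_suml -!sumrB mulr_sumr; apply: eq_bigr => i _.
  rewrite !mulr_sumr -!sumrB mulr_sumr; apply: eq_bigr => j _.
  rewrite !mulr_sumr -!sumrB mulr_sumr; apply: eq_bigr => k _.
  by rewrite cE; ring.
by field; rewrite V0 W0.
Qed.

Lemma Fn_rank_one : Fn ip X mu = 20.
Proof.
have hM := rank_one_is_moment.
have [sM mM] := hM.
have [sN mN] : is_moment ip X mu (moment ip X mu) := xgetI 0 hM.
(* Any two moments have the same norm: each is paired with the other, and the trace is symmetric.
   Thus [moment] may be replaced by the explicit matrix. *)
have E : ipM ip (moment ip X mu) (moment ip X mu) = ipM ip rank_one_moment rank_one_moment.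
  rewrite (mN _ sN) -(mM _ sN) (ipM_selfadjoint _ sN).
  rewrite mxtrace_mulC -(ipM_selfadjoint _ sM).
  by rewrite (mN _ sM) -(mM _ sM).
apply: complexI; rewrite /Fn.
rewrite E (ipM_selfadjoint _ sM).
have Vv : ip v v = V%:C by rewrite (sqE _ hX).
have Ww : ip w w = W%:C by rewrite (sqE _ hX).
have [V0 W0] : V != 0 /\ W != 0 by split; [exact: (sq_eq0 hX v0)|exact: (sq_eq0 hX w0)].
have wv : ip w v = 0 by rewrite -ipC vw conjC0.
(* As [v] and [w] are orthogonal eigenvectors for 2 and -4, the value is 4 + 16. *)
rewrite mxtrace_rank_one_moment !rank_one_momentE vw wv !mulr0 !scale0r.
rewrite subr0 sub0r -[- (_ *: w)]scaleNr !ipZl Vv Ww.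
have H (p q x y : R) : p%:C * (p%:C * x%:C * x%:C) - q%:C * (- (q%:C * y%:C) * y%:C) =
    (p * (p * x * x) - q * (- (q * y) * y))%:C.
  by rewrite rmorphB !rmorphM rmorphN rmorphM.
rewrite {}H.
by congr (_ %:C); rewrite /=; field; rewrite V0 W0.
Qed.

End RankOne.

(** * Products isomorphic to the model algebra *)

Section Isomorphism.
Variables (R : realType) (n : nat).
Local Notation C := R[i].
Variable ip : {dot 'cV[C]_n for conjC}.

Definition rank_one_product (v w : 'cV[C]_n) : product R n :=
  fun x y => (ip x w * ip y w) *: v.

Fact rank_one_product_is_bilinear v w : bilinear_for
  (GRing.Scale.Law.clone _ _ *:%R _) (GRing.Scale.Law.clone _ _ *:%R _)
  (rank_one_product v w).
Proof.
split=> z a x y; rewrite /rank_one_product ipDl ipZl.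
  by rewrite mulrDl scalerDl -mulrA /= scalerA.
by rewrite mulrDr scalerDl mulrCA /= scalerA.
Qed.

HB.instance Definition _ v w := bilinear_isBilinear.Build C 'cV[C]_n 'cV[C]_n 'cV[C]_n
  *:%R *:%R (rank_one_product v w) (rank_one_product_is_bilinear v w).

(** All triple products vanish because [v] is orthogonal to [w], while the square of [w] is
    nonzero. *)
Lemma rank_one_product_Ln v w : v != 0 -> w != 0 -> ip v w = 0 ->
  Ln_rep (rank_one_product v w).
Proof.
move=> v0 w0 vw; split=> [/(congr1 (fun mu => mu w w))/eqP|x y z].
  by rewrite /rank_one_product scaler_eq0 (negPf v0) orbF mulf_eq0 orbb dnorm_eq0 (negPf w0).
by rewrite /rank_one_product !ipZl vw !(mulr0, mul0r) !scale0r addr0.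
Qed.

Variable mu : {bilinear 'cV[C]_n -> 'cV[C]_n -> 'cV[C]_n}.
Variable m : nat.

Lemma direct_sum_nonlie2E (x y : 'cV[C]_(2 + m)) :
  direct_sum (@nonlie2 R) (@trivial_alg R m) x y =
  (x (lshift m 0) 0 * y (lshift m 0) 0) *: delta_mx (lshift m 1) 0.
Proof.
apply/matrixP => i j; rewrite ord1 /direct_sum /nonlie2 /trivial_alg !mxE.
have E : (i == lshift m 1) = ((i : nat) == 1%N) by rewrite -val_eqE.
case: splitP => k ik; rewrite !mxE E ik; first by rewrite -val_eqE.
by rewrite mulr0.
Qed.

Lemma isomorphic_rank_one X : onb ip X ->
  isomorphic mu (direct_sum (@nonlie2 R) (@trivial_alg R m)) ->
  exists v w, [/\ v != 0, w != 0, ip v w = 0 &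
    forall x y, mu x y = (ip x w * ip y w) *: v].
Proof.
move=> hX [f [[g fK gK] fM]].
(* [w] represents the linear form sending x to the e1-coordinate of [f x]; the preimage of e2 will
   be [v], orthogonal to [w] because e2 has e1-coordinate 0. *)
pose w := \sum_i conjC (f (X i) (lshift m 0) 0) *: X i.
have wE x : ip x w = f x (lshift m 0) 0.
  rewrite /w ip_sumr [in RHS](onb_expand x hX) linear_sum summxE; apply: eq_bigr => i _.
  by rewrite ipZr conjCK linearZ mxE mulrC.
exists (g (delta_mx (lshift m 1) 0)), w; split.
- apply/eqP => /(congr1 f)/matrixP/(_ (lshift m 1) 0)/eqP.
  by rewrite gK linear0 !mxE !eqxx oner_eq0.
- apply/eqP => w0; have /eqP := wE (g (delta_mx (lshift m 0) 0)).
  by rewrite gK mxE !eqxx w0 -ipC ip0l conjC0 eq_sym oner_eq0.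
- by rewrite wE gK mxE.
- move=> x y; apply: (can_inj fK).
  by rewrite fM direct_sum_nonlie2E linearZ /= gK !wE.
Qed.

(** The isomorphism takes coordinates in [Y], reordered so that [i] and [k] come first, and divides
    the [k]-th one by [c], so that [c *: Y k] goes to e2. *)
Lemma rank_one_isomorphic (Y : 'I_n -> 'cV[C]_n) i k c : (2 + m = n)%N ->
  onb ip Y -> k != i -> c != 0 ->
  (forall x y, mu x y = (ip x (Y i) * ip y (Y i)) *: (c *: Y k)) ->
  isomorphic mu (direct_sum (@nonlie2 R) (@trivial_alg R m)).
Proof.
move=> e; move: ip mu Y i k; case: n / e => ip' mu' Y i k hY ki c0 muE.
pose l0 : 'I_(2 + m) := lshift m 0; pose l1 : 'I_(2 + m) := lshift m 1.
have [s [s0 s1]] : exists s : 'S_(2 + m), s l0 = i /\ s l1 = k.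
  (* The second transposition moves [t l1] to [k] and fixes [i], which differs from both. *)
  pose t := tperm l0 i; have t0 : t l0 = i by exact: tpermL.
  exists (t * tperm (t l1) k)%g; rewrite !permM t0 tpermL; split=> //.
  by apply: tpermD => //; rewrite -t0 (inj_eq perm_inj).
pose Z j := Y (s j).
have hZ : onb ip' Z by move=> a b; rewrite hY (inj_eq perm_inj).
pose d : 'rV[C]_(2 + m) := \row_j (if j == l1 then c^-1 else 1).
pose F := diag_mx d *m ((basis_mx Z) ^t conjC *m gram ip').
have FE x j : (F *m x) j 0 = d 0 j * ip' x (Z j).
  by rewrite /F -mulmxA mul_diag_mx mxE mulmx_basis col_id.
have Fu : F \in unitmx.
  rewrite unitmx_mul; apply/andP; split.
    rewrite unitmxE det_diag unitfE; apply/prodf_neq0 => j _; rewrite mxE.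
    by case: ifP => _; rewrite ?invr_eq0 ?oner_eq0.
  exact: (mulmx1_unit (basis_mxKl hZ)).1.
exists (mulmx F); split.
  by exists (mulmx (invmx F)); [exact: mulKmx|exact: mulKVmx].
move=> x y; rewrite direct_sum_nonlie2E.
apply/matrixP => j l; rewrite ord1 [RHS]mxE !FE muE -/l0 -/l1 !mxE /Z s0 eqxx andbT.
rewrite !ipZl hY -s1 (inj_eq perm_inj) (eq_sym l1) /= !mul1r.
by case: eqP => _; rewrite ?mulr0// !mulr1 mulrCA mulVf ?mulr1.
Qed.

End Isomorphism.

(** * The maximizers of [Fn] on Leibniz algebras *)

Theorem theorem4p9 (R : realType) (n : nat) (hn : (2 <= n)%N)
    (ip : {dot 'cV[R[i]]_n for conjC})
    (X : n.-tuple 'cV[R[i]]_n) (hX : orthonormal ip X)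
    (mu : {bilinear 'cV[R[i]]_n -> 'cV[R[i]]_n -> 'cV[R[i]]_n})
    (hmu : Ln_rep mu) :
  ((forall lam : {bilinear 'cV[R[i]]_n -> 'cV[R[i]]_n -> 'cV[R[i]]_n},
      Ln_rep lam -> Fn ip X lam <= Fn ip X mu)
   <-> isomorphic mu (direct_sum (@nonlie2 R) (@trivial_alg R (n - 2))))
  /\ (isomorphic mu (direct_sum (@nonlie2 R) (@trivial_alg R (n - 2)))
      -> Fn ip X mu = 20).
Proof.
have {}hX := orthonormal_onb hX; have [mu0 _] := hmu.
have iso20 : isomorphic mu (direct_sum (@nonlie2 R) (@trivial_alg R (n - 2))) ->
    Fn ip X mu = 20.
  by move=> /(isomorphic_rank_one hX)[v [w [v0 w0 vw muE]]]; exact: Fn_rank_one muE.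
split; last exact: iso20.
split=> [mu_max|/iso20 -> lam [lam0 _]]; last exact: Fn_le20 hX lam0.
(* [hn] reads as 1 < n, so [v] and [w] are the basis vectors of index 1 and 0; their rank one
   product is a competitor reaching 20. *)
pose v := tnth X (Ordinal hn); pose w := tnth X (Ordinal (ltnW hn)).
have norm1 i : tnth X i != 0 by rewrite -(dnorm_eq0 ip) hX eqxx oner_eq0.
have vw : ip v w = 0 by rewrite hX.
have F20 : Fn ip X mu = 20.
  apply: le_anti; rewrite (Fn_le20 hX mu0) /=.
  have <- : Fn ip X (rank_one_product ip v w) = 20.
    by apply: (Fn_rank_one hX (norm1 _) (norm1 _) vw).
  by apply: mu_max; exact: rank_one_product_Ln (norm1 _) (norm1 _) vw.
have [Y [i [k [c [hY ki c0 muE]]]]] := Fn_eq20 hX mu0 F20.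
exact: rank_one_isomorphic (subnKC hn) hY ki c0 muE.
Qed.
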